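(* Let $m\ge 1$ be an integer and let $X$ be a finite $m$-almost quasigroup quandle such that for every $a\in X$ the stabilizer set $S_a=\{x\in X\mid a*x=a\}$ is a trivial subquandle of $X$ (i.e. $x*y=x$ for all $x,y\in S_a$). If $X$ is nontrivial (i.e. $X$ is not a trivial quandle), then the reduced quandle homology of $X$ is annihilated by $N=m\cdot\operatorname{lcm}(|X|,|X|-m)$; that is, $N\,\widetilde{H}_n^Q(X)=0$ for every $n$.
   Context: A quandle is a set $X$ with a binary operation $*$ such that: (1) $a*a=a$ for all $a$; (2) for each $b\in X$ the map $*_b:X\to X$, $x\mapsto x*b$, is a bijection; (3) $(a*b)*c=(a*c)*(b*c)$ for all $a,b,c$. The inverse of $*_b$ is written $x\mapsto x\,\overline{*}\,b$. A subquandle is a subset closed under $*$ and $\overline{*}$. A (sub)quandle is trivial if $x*y=x$ for all its elements $x,y$. For $a\in X$ put $S_a=\{x\in X\mid a*x=a\}$. The quandle $X$ is $m$-almost quasigroup if (i) for each $a\in X$ the set $S_a$ has exactly $m$ elements; and (ii) for each $a\in X$ and each $b\in X\setminus S_a$, the equation $a*x=b$ has a unique solution $x\in X$. Rack and quandle homology: $C_n^R(X)$ is the free abelian group on the set $X^n$ of $n$-tuples, and the boundary map $\partial_n:C_n^R(X)\to C_{n-1}^R(X)$ is $$\partial_n(x_1,\ldots,x_n)=\sum_{i=1}^n(-1)^i\big[(x_1,\ldots,x_{i-1},x_{i+1},\ldots,x_n)-(x_1*x_i,\ldots,x_{i-1}*x_i,x_{i+1},\ldots,x_n)\big].$$ $C_n^D(X)\subseteq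 C_n^R(X)$ is the subgroup generated by the $n$-tuples with $x_i=x_{i+1}$ for some $1\le i\le n-1$; it is a subcomplex. The quandle chain complex is $C_n^Q(X)=C_n^R(X)/C_n^D(X)$ with the induced boundary, and $H_n^Q(X)$ is its $n$th homology group (integer coefficients). Reduced quandle homology $\widetilde{H}_n^Q(X)$, $n\ge 1$, is the homology of the augmented complex $\cdots\to C_2^Q(X)\xrightarrow{\partial_2}C_1^Q(X)\xrightarrow{\varepsilon}\mathbb{Z}$, where $\varepsilon(x)=1$ for each $x\in X$; thus $\widetilde{H}_n^Q(X)=H_n^Q(X)$ for $n\ge 2$ and $\widetilde{H}_1^Q(X)=\ker\varepsilon/\operatorname{im}\partial_2$. *)

(* Defs.v *)
From HB Require Import structures.
(* [freeg] comes first, so that [lift] is the one of [fintype]. *)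
From mathcomp Require Import freeg.
From mathcomp Require Import all_boot all_order all_algebra zify boolp.

Set Implicit Arguments.
Unset Strict Implicit.
Unset Printing Implicit Defensive.

Import GRing.Theory.
Import Quotient.Exports.
Local Open Scope ring_scope.
Local Open Scope quotient_scope.

HB.mixin Record isQuandle (X : Type) := {
  qop : X -> X -> X;
  qopxx : forall a, qop a a = a;
  qop_bij : forall b, bijective (fun x => qop x b);
  qopD : forall a b c, qop (qop a b) c = qop (qop a c) (qop b c)
}.

#[short(type="finQuandleType")]
HB.structure Definition FinQuandle := {X of isQuandle X & Finite X}.

Section Quandle.
Variable X : finQuandleType.
Implicit Types (a b x y : X) (S : {set X}).

(* The inverse of the bijection [qop^~ b]. *)
Definition qopinv x b : X := invF (bij_inj (qop_bij b)) x.

Definition subquandle S :=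
  forall x y, x \in S -> y \in S -> qop x y \in S /\ qopinv x y \in S.

Definition trivial_on S := forall x y, x \in S -> y \in S -> qop x y = x.

Definition trivial_subquandle S := subquandle S /\ trivial_on S.

Definition trivial_quandle := trivial_on [set: X].

Definition qstab a : {set X} := [set x | qop a x == a].

Definition almost_quasigroup (m : nat) :=
  (forall a, #|qstab a| = m) /\
  (forall a b, b \notin qstab a -> exists! x, qop a x = b).

End Quandle.

Section GeneratedSubgroup.
Variables (V : zmodType) (A : {pred V}).

Definition gen_subgroup : {pred V} :=
  fun v => `[< forall G : zmodClosed V, {subset A <= G} -> v \in G >].

Lemma gen_subgroup_sub : {subset A <= gen_subgroup}.
Proof. by move=> v Av; apply/asboolP => G; apply. Qed.

Lemma gen_subgroup_min (G : zmodClosed V) :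
  {subset A <= G} -> {subset gen_subgroup <= G}.
Proof. by move=> AG v /asboolP; apply. Qed.

Lemma gen_subgroup_zmod_closed : zmod_closed gen_subgroup.
Proof.
split=> [|u v /asboolP Hu /asboolP Hv]; apply/asboolP => G AG.
  exact: rpred0.
by rewrite rpredB ?Hu ?Hv.
Qed.

HB.instance Definition _ :=
  GRing.isZmodClosed.Build V gen_subgroup gen_subgroup_zmod_closed.

End GeneratedSubgroup.

Section Homology.
Variables (A B C : zmodType) (f : {additive A -> B}) (g : {additive B -> C}).

Definition kernel_pred : {pred B} := [pred x | g x == 0].

Lemma kernel_pred_zmod_closed : zmod_closed kernel_pred.
Proof.
split=> [|u v]; rewrite !inE ?raddf0 // raddfB => /eqP -> /eqP ->.
by rewrite subr0.
Qed.

HB.instance Definition _ :=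
  GRing.isZmodClosed.Build B kernel_pred kernel_pred_zmod_closed.

Record cycle_group := Cycle { cycle_val :> B; _ : cycle_val \in kernel_pred }.

HB.instance Definition _ := [isSub for cycle_val].
HB.instance Definition _ := [Choice of cycle_group by <:].
HB.instance Definition _ := [SubChoice_isSubZmodule of cycle_group by <:].

Definition boundaries : {pred cycle_group} :=
  fun z => `[< exists a, f a = cycle_val z >].

Lemma boundaries_zmod_closed : zmod_closed boundaries.
Proof.
split=> [|u v /asboolP [a fa] /asboolP [b fb]]; apply/asboolP.
  by exists 0; rewrite raddf0.
by exists (a - b); rewrite raddfB fa fb.
Qed.

HB.instance Definition _ :=
  GRing.isZmodClosed.Build cycle_group boundaries boundaries_zmod_closed.

(* Kernel modulo image when [g \o f = 0]; [aug_bd_bd] below supplies this where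
   it is used. *)
Definition homology : zmodType := Quotient.quot boundaries.

End Homology.

Section Chains.
Variable X : finQuandleType.

Definition rack_chain n : lmodType int := {freeg (n.-tuple X) / int}.

(* [lift i] enumerates increasingly the positions other than [i], so that
   [act_del] yields (x_1 * x_i, ..., x_{i-1} * x_i, x_{i+1}, ..., x_n). *)
Definition del n (i : 'I_n.+1) (t : n.+1.-tuple X) : n.-tuple X :=
  [tuple tnth t (lift i j) | j < n].

Definition act_del n (i : 'I_n.+1) (t : n.+1.-tuple X) : n.-tuple X :=
  [tuple if (lift i j < i)%N then qop (tnth t (lift i j)) (tnth t i)
         else tnth t (lift i j) | j < n].

(* Positions are numbered from 0 here, hence the exponent [i.+1]. *)
Definition bd_tuple n (t : n.+1.-tuple X) : rack_chain n :=
  \sum_(i < n.+1) (-1) ^+ i.+1 *: (<< del i t >> - << act_del i t >>).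

Definition bd n : rack_chain n.+1 -> rack_chain n := fglift (@bd_tuple n).

HB.instance Definition _ n :=
  GRing.isAdditive.Build (rack_chain n.+1) (rack_chain n) (@bd n)
    (lift_is_additive (@bd_tuple n)).

Definition degenerate n (t : n.-tuple X) : Prop :=
  exists i j : 'I_n, j = i.+1 :> nat /\ tnth t i = tnth t j.

Definition degenerate_basis n : {pred rack_chain n} :=
  fun c => `[< exists2 t : n.-tuple X, degenerate t & c = << t >> >].

Definition degenerate_chain n : zmodClosed (rack_chain n) :=
  gen_subgroup (@degenerate_basis n).

Definition quandle_chain n : zmodType := Quotient.quot (degenerate_chain n).

Definition to_quandle n : {additive rack_chain n -> quandle_chain n} :=
  \pi_(quandle_chain n).

Lemma to_quandle_eq0 n (c : rack_chain n) :
  (to_quandle n c == 0) = (c \in degenerate_chain n).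
Proof.
rewrite -(raddf0 (to_quandle n)) /to_quandle /=.
by rewrite -Quotient.idealrBE subr0.
Qed.

Lemma bd_basis n (t : n.+1.-tuple X) : bd << t >> = bd_tuple t.
Proof. by rewrite /bd liftU scale1r. Qed.

Lemma degenerate_in n (t : n.-tuple X) :
  degenerate t -> << t >> \in degenerate_chain n.
Proof. by move=> dt; apply: gen_subgroup_sub; apply/asboolP; exists t. Qed.

Lemma bd_tuple_degenerate n (t : n.+1.-tuple X) :
  degenerate t -> bd_tuple t \in degenerate_chain n.
Proof.
move=> [p [q [qp tpq]]].
have neq_qp : q != p by rewrite -val_eqE /= qp neq_ltn ltnSn orbT.
rewrite /bd_tuple (bigD1 p) //= (bigD1 q) //= addrA rpredD //.
  have -> : del q t = del p t.
    apply: eq_from_tnth => j; rewrite !tnth_mktuple.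
    have [jp | njp] := eqVneq (j : nat) p.
      have -> : lift q j = p by apply: val_inj; rewrite /= /bump qp jp ltnn.
      by have -> : lift p j = q by apply: val_inj; rewrite /= /bump qp jp leqnn.
    congr (tnth t _); apply: val_inj; rewrite /= /bump qp.
    by rewrite (leq_eqVlt p) eq_sym (negPf njp).
  have -> : act_del q t = act_del p t.
    apply: eq_from_tnth => j; rewrite !tnth_mktuple.
    have [jp | njp] := eqVneq (j : nat) p.
      have -> : lift q j = p by apply: val_inj; rewrite /= /bump qp jp ltnn.
      have -> : lift p j = q by apply: val_inj; rewrite /= /bump qp jp leqnn.
      by rewrite qp ltnSn ltnNge leqnSn /= -tpq qopxx.
    have -> : lift q j = lift p j.
      apply: val_inj; rewrite /= /bump qp.
      by rewrite (leq_eqVlt p) eq_sym (negPf njp).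
    have njp' : lift p j != p :> nat by rewrite val_eqE eq_sym neq_lift.
    by rewrite -tpq qp ltnS leq_eqVlt (negPf njp').
  by rewrite qp (exprS _ p.+1) mulN1r scaleNr subrr rpred0.
apply: rpred_sum => k /andP [kp kq].
have [p' def_p _] := unlift_some kp; have [q' def_q _] := unlift_some kq.
have val_p : p = ((k <= p') + p')%N :> nat by rewrite {1}def_p.
have val_q : q = ((k <= q') + q')%N :> nat by rewrite {1}def_q.
have neq_kp : (k : nat) <> p by move/val_inj/eqP; rewrite (negPf kp).
have neq_kq : (k : nat) <> q by move/val_inj/eqP; rewrite (negPf kq).
have qp' : q' = p'.+1 :> nat by lia.
have eq_ltk : (p < k)%N = (q < k)%N by lia.
rewrite -signr_odd scaler_sign.
suff : << del k t >> - << act_del k t >> \in degenerate_chain n.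
  by case: odd => //; rewrite rpredN.
rewrite rpredB // degenerate_in //; exists p', q'; split => //.
  by rewrite !tnth_mktuple -def_p -def_q.
by rewrite !tnth_mktuple -def_p -def_q eq_ltk tpq.
Qed.

Lemma bd_degenerate n (c : rack_chain n.+1) :
  c \in degenerate_chain n.+1 -> bd c \in degenerate_chain n.
Proof.
pose h : {additive _ -> _} := to_quandle n \o @bd n.
rewrite -to_quandle_eq0 => dc.
have sub : {subset @degenerate_basis n.+1 <= kernel_pred h}.
  move=> _ /asboolP [t dt ->]; rewrite inE /= to_quandle_eq0 bd_basis.
  exact: bd_tuple_degenerate.
have := gen_subgroup_min sub; move=> /(_ c); rewrite inE /= to_quandle_eq0.
by apply; rewrite -to_quandle_eq0.
Qed.

(* The value does not depend on the representative: see [qbd_to_quandle]. *)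
Definition qbd n (c : quandle_chain n.+1) : quandle_chain n :=
  to_quandle n (bd (repr c)).

Lemma qbd_to_quandle n (c : rack_chain n.+1) :
  qbd (to_quandle n.+1 c) = to_quandle n (bd c).
Proof.
apply/eqP; rewrite /qbd -subr_eq0 -!raddfB to_quandle_eq0.
apply: bd_degenerate.
by rewrite -to_quandle_eq0 raddfB subr_eq0 /to_quandle /= reprK.
Qed.

Lemma to_quandle_repr n (c : quandle_chain n) : to_quandle n (repr c) = c.
Proof. exact: reprK. Qed.

Lemma qbd_zmod_morphism n : zmod_morphism (@qbd n).
Proof.
move=> c d; rewrite -(to_quandle_repr c) -(to_quandle_repr d) -raddfB.
by rewrite !qbd_to_quandle !raddfB.
Qed.

HB.instance Definition _ n :=
  GRing.isZmodMorphism.Build (quandle_chain n.+1) (quandle_chain n) (@qbd n)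
    (@qbd_zmod_morphism n).

Definition face n (e : bool) (i : 'I_n.+1) (t : n.+1.-tuple X) :=
  if e then act_del i t else del i t.

Lemma tnth_face n e i (t : n.+1.-tuple X) j :
  tnth (face e i t) j =
  if e && (lift i j < i)%N then qop (tnth t (lift i j)) (tnth t i)
  else tnth t (lift i j).
Proof. by case: e; rewrite /= !tnth_mktuple. Qed.

(* A pair [(i, j)] encodes the removal of position [i], then of the [j]-th
   remaining one; [swap_face] exchanges the order of the two removals. *)
Definition swap_face n (p : 'I_n.+2 * 'I_n.+1) : 'I_n.+2 * 'I_n.+1 :=
  (lift p.1 p.2, odflt ord0 (unlift (lift p.1 p.2) p.1)).

Lemma lift_swap_face n (p : 'I_n.+2 * 'I_n.+1) :
  lift (swap_face p).1 (swap_face p).2 = p.1.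
Proof.
rewrite /swap_face /=.
case: (unliftP (lift p.1 p.2) p.1) => [j /= <- // | /eqP].
by rewrite (negPf (neq_lift _ _)).
Qed.

Lemma swap_faceK n : involutive (@swap_face n).
Proof.
move=> p; rewrite {1}/swap_face lift_swap_face.
by rewrite /swap_face /= liftK; case: p.
Qed.

Lemma faceC n e1 e2 (p : 'I_n.+2 * 'I_n.+1) (t : n.+2.-tuple X) :
  face e1 p.2 (face e2 p.1 t) =
  face e2 (swap_face p).2 (face e1 (swap_face p).1 t).
Proof.
have := lift_swap_face p; move def_q : (swap_face p) => q lift_q.
have lift_p : lift p.1 p.2 = q.1 by rewrite -def_q.
case: p q {def_q} lift_q lift_p => i j [k j'] /= kj' ij.
apply: eq_from_tnth => l; rewrite !tnth_face ij kj'.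
have eq_m : lift k (lift j' l) = lift i (lift j l).
  move: (congr1 val kj') (congr1 val ij) => /=; rewrite /bump => v1 v2.
  apply: val_inj; rewrite /= /bump; lia.
rewrite eq_m; set m := lift i (lift j l).
have ltj : (lift j l < j)%N = (m < k)%N.
  rewrite /m -ij /= /bump; lia.
have ltj' : (lift j' l < j')%N = (m < i)%N.
  rewrite /m -eq_m -kj' /= /bump; lia.
have neq_ik : i != k :> nat by rewrite val_eqE -ij neq_lift.
rewrite ltj ltj'; case: (ltngtP i k) neq_ik => // ltik _.
  case: (ltnP m i) => mi; case: (ltnP m k) => mk; try lia;
    by case: e1 e2 => [] [] //=; rewrite [LHS]qopD.
case: (ltnP m i) => mi; case: (ltnP m k) => mk; try lia;
  by case: e1 e2 => [] [] //=; rewrite [RHS]qopD.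
Qed.

Lemma bd_tuple_face n (t : n.+1.-tuple X) :
  bd_tuple t =
  \sum_(i < n.+1) \sum_(e : bool) (-1) ^+ (e + i.+1) *: << face e i t >>.
Proof.
apply: eq_bigr => i _; rewrite big_bool /= addrC add1n add0n.
by rewrite (exprS _ i.+1) mulN1r scaleNr scalerBr.
Qed.

Lemma bdZ n (a : int) (c : rack_chain n.+1) : bd (a *: c) = a *: bd c.
Proof. by rewrite -[a]intz !scaler_int raddfMz. Qed.

Lemma bd_bd_tuple n (t : n.+2.-tuple X) : bd (bd_tuple t) = 0.
Proof.
pose G (p : 'I_n.+2 * 'I_n.+1) : rack_chain n :=
  \sum_(e2 : bool) \sum_(e1 : bool)
    (-1) ^+ (e1 + e2) *: << face e1 p.2 (face e2 p.1 t) >>.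
have -> : bd (bd_tuple t) = 
    \sum_(p : 'I_n.+2 * 'I_n.+1) (-1) ^+ (p.1 + p.2) *: G p.
  rewrite bd_tuple_face raddf_sum /= 
    -(pair_bigA _ (fun (i : 'I_n.+2) (j : 'I_n.+1) =>
       (-1) ^+ (i + j) *: G (i, j))) /=.
  apply: eq_bigr => i _; rewrite raddf_sum /=.
  under [RHS]eq_bigr => j _ do rewrite scaler_sumr.
  rewrite exchange_big; apply: eq_bigr => e2 _.
  rewrite bdZ bd_basis bd_tuple_face scaler_sumr; apply: eq_bigr => j _.
  rewrite !scaler_sumr; apply: eq_bigr => e1 _.
  rewrite !scalerA -!exprD -[in LHS]signr_odd -[in RHS]signr_odd.
  congr (_ *: _); rewrite !oddD /=.
  by case: (odd i) (odd j) (odd e1) (odd e2) => [] [] [] [].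
set S := LHS.
have SN : S = - S.
  rewrite {1}/S (reindex_inj (inv_inj (@swap_faceK n))) /= /S -sumrN.
  apply: eq_bigr => p _.
  have -> : G (swap_face p) = G p.
    rewrite /G exchange_big; apply: eq_bigr => e2 _; apply: eq_bigr => e1 _.
    by rewrite [in RHS]faceC addnC.
  rewrite -scaleNr -[- (_ ^+ _)]mulN1r -exprS.
  rewrite -[in LHS]signr_odd -[in RHS]signr_odd; congr (_ ^+ nat_of_bool _ *: _).
  have := lift_swap_face p; case: p => i j /= /(congr1 val) /=.
  rewrite /bump; lia.
apply/eqP/freeg_eqP => u; rewrite coeff0.
by have := congr1 (coeff u) SN; rewrite coeffN; lia.
Qed.

Lemma bd_bd n (c : rack_chain n.+2) : bd (bd c) = 0.
Proof.
rewrite -[c]freeg_sumE !raddf_sum big1 //= => t _.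
have -> : << coeff t c *g t >> = coeff t c *: << t >> :> rack_chain n.+2.
  by apply/eqP/freeg_eqP => u; rewrite coeffZ !coeffU mul1r.
by rewrite !bdZ bd_basis bd_bd_tuple scaler0.
Qed.

Lemma qbd_qbd n (c : quandle_chain n.+2) : qbd (qbd c) = 0.
Proof.
by rewrite -(to_quandle_repr c) !qbd_to_quandle bd_bd raddf0.
Qed.

Definition augmentation (c : quandle_chain 1) : int := deg (repr c).

Lemma deg_degenerate (c : rack_chain 1) : c \in degenerate_chain 1 -> deg c = 0.
Proof.
have sub : {subset @degenerate_basis 1 <= kernel_pred (@deg (1.-tuple X))}.
  by move=> c' /asboolP [t [i [j]] + _]; rewrite (ord1 i) (ord1 j) => -[].
by move/(gen_subgroup_min sub); rewrite inE => /eqP.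
Qed.

Lemma augmentation_to_quandle (c : rack_chain 1) :
  augmentation (to_quandle 1 c) = deg c.
Proof.
apply/eqP; rewrite /augmentation -subr_eq0 -degB; apply/eqP/deg_degenerate.
by rewrite -to_quandle_eq0 raddfB subr_eq0 to_quandle_repr.
Qed.

Lemma augmentation_basis x : augmentation (to_quandle 1 << [tuple x] >>) = 1.
Proof. by rewrite augmentation_to_quandle degU. Qed.

Lemma augmentation_zmod_morphism : zmod_morphism augmentation.
Proof.
move=> c d; rewrite -(to_quandle_repr c) -(to_quandle_repr d) -raddfB.
by rewrite !augmentation_to_quandle raddfB.
Qed.

HB.instance Definition _ :=
  GRing.isZmodMorphism.Build (quandle_chain 1) int augmentation
    augmentation_zmod_morphism.

Lemma augmentation_qbd (c : quandle_chain 2) : augmentation (qbd c) = 0.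
Proof.
rewrite -(to_quandle_repr c) qbd_to_quandle augmentation_to_quandle.
rewrite -[repr c]freeg_sumE !raddf_sum big1 //= => t _.
have -> : << coeff t (repr c) *g t >> =
          coeff t (repr c) *: << t >> :> rack_chain 2.
  by apply/eqP/freeg_eqP => u; rewrite coeffZ !coeffU mul1r.
rewrite -[coeff _ _]intz scaler_int !raddfMz /= bd_basis.
rewrite raddf_sum big1 ?mul0rz //= => i _.
by rewrite -[_ ^+ _]intz scaler_int raddfMz raddfB /= !degU subrr mul0rz.
Qed.

Definition aug_chain n : zmodType :=
  if n is k.+1 then quandle_chain k.+1 else int.

Definition aug_bd n : {additive aug_chain n.+1 -> aug_chain n} :=
  match n with
  | 0 => augmentation
  | k.+1 => @qbd k.+1
  end.

(* The differential leaving degree [n]; it is zero in degree 0. *)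
Definition aug_bd_out n : {additive aug_chain n -> aug_chain n.-1} :=
  match n with
  | 0 => \0
  | k.+1 => aug_bd k
  end.

Lemma aug_bd_bd n (c : aug_chain n.+1) : aug_bd_out n (aug_bd n c) = 0.
Proof.
by case: n c => [|[|n]] c //=; [exact: augmentation_qbd | exact: qbd_qbd].
Qed.

Definition reduced_homology n : zmodType := homology (aug_bd n) (aug_bd_out n).

End Chains.

(* Main.v *)
(** Put [k = |X| - m].  Inserting every [y] in second position, [cyl], is a null
homotopy of [spread = |X| id - R], where [R] replaces the first entry [a] by the
sum of the [a * y].  By the two hypotheses on the stabilizers, which partition
[X], [spread] is [k + sigma - tau], where [sigma] and [tau] replace [a] by the
sum of its stabilizer and by the sum of [X], respectively.  As
[sigma^2 = m sigma], [tau sigma = m tau] and [spread tau = 0], this gives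
[(2k + m) spread - spread^2 = k |X| - k tau].

In degree 1, [tau] vanishes on the kernel of the augmentation.  In higher
degree, [cyl] does not preserve degenerate chains, but it does after the chain
map [red = 1 - dup], where [dup] replaces the first entry by the second one;
moreover [tau red = 0], and [red] is the identity modulo degenerate chains.
Hence [k |X|], which divides [m lcm(|X|, k)], annihilates the homology. *)

Require Import Defs.
From HB Require Import structures.
From mathcomp Require Import freeg.
From mathcomp Require Import all_boot all_order all_algebra.
From mathcomp Require Import zify ring boolp.

Set Implicit Arguments.
Unset Strict Implicit.
Unset Printing Implicit Defensive.

Import GRing.Theory.
Local Open Scope ring_scope.

(** * Free abelian groups, divisibility, and torsion in homology *)

Lemma freeg_additive_ext (K : choiceType) (V : zmodType)
    (f g : {additive {freeg K / int} -> V}) :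
  (forall x, f << x >> = g << x >>) -> f =1 g.
Proof.
move=> fg D; rewrite -[D]freeg_sumE !raddf_sum /=; apply: eq_bigr => x _.
have -> : << coeff x D *g x >> = << x >> *~ coeff x D :> {freeg K / int}.
  by rewrite freeg_mulz intz.
by rewrite !raddfMz fg.
Qed.

Lemma raddfZ_int (U V : lmodType int) (f : {additive U -> V}) (a : int) u :
  f (a *: u) = a *: f u.
Proof. by rewrite -[a]intz !scaler_int raddfMz. Qed.

(** The lcm and the gcd of [k + m] and [k] multiply to [k * (k + m)], and this gcd divides [m]. *)
Lemma dvdn_mul_mul_lcm k m : (k * (k + m) %| m * lcmn (k + m) k)%N.
Proof.
rewrite (mulnC k) -muln_lcm_gcd (mulnC m) dvdn_mul //.
by rewrite gcdnC gcdnDl dvdn_gcdr.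
Qed.

Lemma homology_mulrn_eq0 (A B C : zmodType) (f : {additive A -> B})
    (g : {additive B -> C}) (N : nat) :
  (forall b, g b = 0 -> exists a, f a = b *+ N) ->
  forall h : homology f g, h *+ N = 0.
Proof.
move=> fgN h; rewrite -[h]reprK; set z := repr h.
have /eqP gz : cycle_val z \in kernel_pred g by case: z.
have [a fa] := fgN _ gz.
rewrite -raddfMn -(raddf0 (\pi_(homology f g))%qT); apply/eqP.
rewrite -Quotient.idealrBE subr0; apply/asboolP; exists a.
by rewrite fa -[RHS]/(val (z *+ N)) raddfMn.
Qed.

Section QuandleChains.
Variable X : finQuandleType.
Implicit Types (a b s x y : X).

(** * Boundaries of tuples with the first entry split off *)

Local Notation "a ::: u" := (cons_tuple a u) (at level 60, right associativity).

(** Where [tupleP] yields [[tuple of _]], this view yields [a ::: u], the form matched by the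
    rewriting rules below. *)
Variant cons_tuple_spec n : n.+1.-tuple X -> Type :=
  ConsTuple a (u : n.-tuple X) : cons_tuple_spec (a ::: u).

Lemma cons_tupleP n (t : n.+1.-tuple X) : cons_tuple_spec t.
Proof.
case/tupleP: t => a u.
by rewrite (_ : [tuple of _] = a ::: u) //; apply: val_inj.
Qed.

Definition extend n p (f : n.-tuple X -> rack_chain X p) :
  rack_chain X n -> rack_chain X p := fglift f.

HB.instance Definition _ n p (f : n.-tuple X -> rack_chain X p) :=
  GRing.isZmodMorphism.Build (rack_chain X n) (rack_chain X p) (extend f)
    (lift_is_additive f).

Lemma extendU n p (f : n.-tuple X -> rack_chain X p) t : extend f << t >> = f t.
Proof. by rewrite /extend liftU scale1r. Qed.

Lemma del_cons n a (i : 'I_n.+1) (u : n.+1.-tuple X) :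
  del (lift ord0 i) (a ::: u) = a ::: del i u.
Proof.
apply: eq_from_tnth => j; rewrite tnth_mktuple.
have [k ->|->] := unliftP ord0 j; last first.
  by rewrite (_ : lift _ _ = ord0) ?tnth0 //; apply: val_inj.
rewrite (_ : lift (lift ord0 i) (lift ord0 k) = lift ord0 (lift i k)).
  by rewrite !tnthS tnth_mktuple.
by apply: val_inj; rewrite /= /bump /=; lia.
Qed.

Lemma act_del_cons n a (i : 'I_n.+1) (u : n.+1.-tuple X) :
  act_del (lift ord0 i) (a ::: u) = qop a (tnth u i) ::: act_del i u.
Proof.
apply: eq_from_tnth => j; rewrite tnth_mktuple tnthS.
have [k ->|->] := unliftP ord0 j; last first.
  by rewrite (_ : lift _ _ = ord0) ?tnth0 //; apply: val_inj.
rewrite (_ : lift (lift ord0 i) (lift ord0 k) = lift ord0 (lift i k)).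
  by rewrite !tnthS tnth_mktuple.
by apply: val_inj; rewrite /= /bump /=; lia.
Qed.

Lemma del0_cons n a (u : n.-tuple X) : del ord0 (a ::: u) = u.
Proof. by apply: eq_from_tnth => j; rewrite tnth_mktuple tnthS. Qed.

Lemma act_del0_cons n a (u : n.-tuple X) : act_del ord0 (a ::: u) = u.
Proof. by apply: eq_from_tnth => j; rewrite tnth_mktuple /= tnthS. Qed.

(** Position 0 contributes nothing: no entry precedes it, so its two faces agree. At position [i.+1]
    the sign [(-1) ^+ i.+2] is [(-1) ^+ i]. *)
Lemma bd_cons n a (u : n.+1.-tuple X) :
  bd << a ::: u >> =
  \sum_(i < n.+1) (-1) ^+ i *:
    (<< a ::: del i u >> - << qop a (tnth u i) ::: act_del i u >>)
  :> rack_chain X n.+1.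
Proof.
rewrite bd_basis /bd_tuple big_ord_recl del0_cons act_del0_cons subrr scaler0.
rewrite add0r; apply: eq_bigr => i _.
by rewrite del_cons act_del_cons !exprS !mulN1r opprK.
Qed.

(** * The operators [cyl], [spread], [total], [dup] and their relations *)

Definition cyl n : rack_chain X n.+1 -> rack_chain X n.+2 :=
  extend (fun t => \sum_y << thead t ::: y ::: behead_tuple t >>).

HB.instance Definition _ n := GRing.Additive.on (@cyl n).

Definition spread n : rack_chain X n.+1 -> rack_chain X n.+1 :=
  extend (fun t => \sum_y
    (<< t >> - << qop (thead t) y ::: behead_tuple t >>)).

HB.instance Definition _ n := GRing.Additive.on (@spread n).

Definition total n : rack_chain X n.+1 -> rack_chain X n.+1 :=
  extend (fun t => \sum_x << x ::: behead_tuple t >>).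

HB.instance Definition _ n := GRing.Additive.on (@total n).

(** A 1-tuple has no second entry; the value 0 there lets [bd_dup] hold down to degree 2. *)
Definition dup n : rack_chain X n.+1 -> rack_chain X n.+1 :=
  extend (match n return n.+1.-tuple X -> rack_chain X n.+1 with
  | 0 => fun=> 0
  | _.+1 => fun t => << thead (behead_tuple t) ::: behead_tuple t >>
  end).

HB.instance Definition _ n := GRing.Additive.on (@dup n).

Lemma behead_tuple_cons n a (u : n.-tuple X) : behead_tuple (a ::: u) = u.
Proof. exact: val_inj. Qed.

Lemma cylU n a (u : n.-tuple X) :
  cyl << a ::: u >> = \sum_y << a ::: y ::: u >>.
Proof. by rewrite /cyl extendU theadE behead_tuple_cons. Qed.

Lemma spreadU n a (u : n.-tuple X) :
  spread << a ::: u >> = \sum_y (<< a ::: u >> - << qop a y ::: u >>).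
Proof. by rewrite /spread extendU theadE behead_tuple_cons. Qed.

Lemma totalU n a (u : n.-tuple X) :
  total << a ::: u >> = \sum_x << x ::: u >>.
Proof. by rewrite /total extendU behead_tuple_cons. Qed.

Lemma dup1 (c : rack_chain X 1) : dup c = 0.
Proof.
apply: (@freeg_additive_ext _ _ (@dup 0) \0) => t /=.
by rewrite /dup extendU.
Qed.

Lemma dupU n a (u : n.+1.-tuple X) : dup << a ::: u >> = << thead u ::: u >>.
Proof. by rewrite /dup extendU behead_tuple_cons. Qed.

Lemma sum_qop (V : zmodType) (F : X -> V) b : \sum_y F (qop y b) = \sum_y F y.
Proof. by rewrite [RHS](reindex_inj (bij_inj (qop_bij b))). Qed.

Lemma bd_cyl1 (c : rack_chain X 1) : bd (cyl c) = spread c.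
Proof.
apply: (@freeg_additive_ext _ _ (@bd X 1 \o @cyl 0) (@spread 0)) => t /=.
case/cons_tupleP: t => a u; rewrite cylU spreadU raddf_sum /=.
apply: eq_bigr => y _.
by rewrite bd_cons big_ord1 expr0 scale1r del0_cons act_del0_cons tnth0.
Qed.

(** Removing the inserted [y] gives [spread]. Every other face cancels against the cylinder over the
    boundary, because acting by an entry of the tuple only permutes the inserted elements. *)
Lemma bd_cyl n (c : rack_chain X n.+2) : bd (cyl c) + cyl (bd c) = spread c.
Proof.
apply: (@freeg_additive_ext _ _
  ((@bd X n.+2 \o @cyl n.+1) \+ (@cyl n \o @bd X n.+1)) (@spread n.+1)) => t /=.
case/cons_tupleP: t => a u; rewrite cylU spreadU !raddf_sum /=.
have e y : bd << a ::: y ::: u >> = << a ::: u >> - << qop a y ::: u >> -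
    \sum_(i < n.+1) (-1) ^+ i *: (<< a ::: y ::: del i u >> -
      << qop a (tnth u i) ::: qop y (tnth u i) ::: act_del i u >>)
    :> rack_chain X n.+2.
  rewrite bd_cons big_ord_recl expr0 scale1r del0_cons act_del0_cons tnth0.
  congr (_ + _); rewrite -sumrN; apply: eq_bigr => i _.
  by rewrite del_cons act_del_cons tnthS exprS mulN1r scaleNr.
rewrite (eq_bigr _ (fun y _ => e y)) sumrB exchange_big /= bd_cons.
rewrite [cyl _]raddf_sum /= -addrA -[RHS]addr0; congr (_ + _).
rewrite addrC -sumrB; apply: big1 => i _.
rewrite -scaler_sumr raddfZ_int raddfB /= !cylU sumrB.
rewrite (sum_qop (fun z => << qop a (tnth u i) ::: z ::: act_del i u >>)).
by rewrite subrr.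
Qed.

Lemma thead_del_lift n i (u : n.+2.-tuple X) :
  thead (del (lift ord0 i) u) = thead u.
Proof. by rewrite /thead tnth_mktuple; congr (tnth u _); apply: val_inj. Qed.

Lemma thead_act_del_lift n i (u : n.+2.-tuple X) :
  thead (act_del (lift ord0 i) u) = qop (thead u) (tnth u (lift ord0 i)).
Proof.
rewrite /thead tnth_mktuple (_ : lift (lift ord0 i) ord0 = ord0) //.
exact: val_inj.
Qed.

(** Removing the second entry gives zero on both sides: its two faces differ only in the first
    entry, which [dup] overwrites, and after [dup] they agree by idempotence. A later entry acts
    alike on the second entry and on its copy. *)
Lemma bd_dup n (c : rack_chain X n.+2) : bd (dup c) = dup (bd c).
Proof.
apply: (@freeg_additive_ext _ _
  (@bd X n.+1 \o @dup n.+1) (@dup n \o @bd X n.+1)) => t /=.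
case/cons_tupleP: t => a u; rewrite dupU !bd_cons raddf_sum /=.
apply: eq_bigr => i _; rewrite [RHS]raddfZ_int /=; congr (_ *: _).
rewrite [RHS]raddfB /=.
have [k ->|->] := unliftP ord0 i; last first.
  case/cons_tupleP: u => b v.
  rewrite theadE del0_cons act_del0_cons tnth0 qopxx subrr.
  case: n c i v => [|n] c i v; first by rewrite !dup1 subrr.
  by rewrite !dupU subrr.
case: n c u i k => [|n] c u i k; first by case: k.
by rewrite !dupU thead_del_lift thead_act_del_lift.
Qed.

(** [spread] alters only the first entry, which [dup] forgets. *)
Lemma dup_spread n (c : rack_chain X n.+1) : dup (spread c) = 0.
Proof.
apply: (@freeg_additive_ext _ _ (@dup n \o @spread n) \0) => t /=.
case/cons_tupleP: t => a u; rewrite spreadU raddf_sum big1 //= => y _.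
case: n c u => [|n] c u; first by rewrite dup1.
by rewrite raddfB /= !dupU subrr.
Qed.

Lemma total_dup n (c : rack_chain X n.+2) : total (dup c) = total c.
Proof.
apply: (@freeg_additive_ext _ _
  (@total n.+1 \o @dup n.+1) (@total n.+1)) => t /=.
by case/cons_tupleP: t => a u; rewrite dupU !totalU.
Qed.

Lemma total1 (c : rack_chain X 1) :
  total c = (\sum_x << [tuple x] >>) *~ deg c.
Proof.
pose f : {additive rack_chain X 1 -> rack_chain X 1} :=
  intmul (\sum_x << [tuple x] >>) \o @deg (1.-tuple X).
apply: (@freeg_additive_ext _ _ (@total 0) f) => t; rewrite /f /=.
case/cons_tupleP: t => a u; rewrite totalU degU mulr1z.
by apply: eq_bigr => x _; congr << _ >>; apply: val_inj; rewrite /= (tuple0 u).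
Qed.

(** * The quadratic relation satisfied by [spread] *)

Section AlmostQuasigroup.
Variable m : nat.
Hypothesis Xm : almost_quasigroup X m.
Hypothesis Xtriv : forall a, trivial_on (qstab a).

Local Notation k := (#|X| - m)%N.

(** Triviality puts [qstab a] inside [qstab s], and both have [m] elements. *)
Lemma qstab_eq a s : s \in qstab a -> qstab s = qstab a.
Proof.
move=> sa; apply/esym/eqP; rewrite eqEcard !(proj1 Xm) leqnn andbT.
by apply/subsetP => t ta; rewrite inE (Xtriv sa ta).
Qed.

(** The preimage [A] of the complement maps onto it by solvability, so it is at least as large; it
    lies in the complement because [qop a] sends [qstab a] to [a], which is in [qstab a]. *)
Lemma qop_image_qstabC a : qop a @: (~: qstab a) = ~: qstab a.
Proof.
pose A := [set y | qop a y \notin qstab a].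
have imA : qop a @: A = ~: qstab a.
  apply/setP => b; rewrite inE; apply/imsetP/idP => [[y]|ba].
    by rewrite inE => ? ->.
  by have [y [yb _]] := proj2 Xm a b ba; exists y; rewrite ?yb // inE yb.
suff eqA : A = ~: qstab a by rewrite -eqA imA eqA.
apply/eqP; rewrite eqEcard -{2}imA leq_imset_card andbT.
by apply/subsetP => y; rewrite !inE; apply: contra => /eqP ->; rewrite qopxx.
Qed.

(** Uniqueness of solutions makes [qop a] injective on the complement, hence a permutation of it. *)
Lemma sum_qop_qstabC a (V : nmodType) (F : X -> V) :
  \sum_(y in ~: qstab a) F (qop a y) = \sum_(y in ~: qstab a) F y.
Proof.
rewrite -[in RHS](qop_image_qstabC a) big_imset //= => y z ya za yz.
have : qop a y \notin qstab a.
  by rewrite -in_setC -(qop_image_qstabC a) imset_f.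
by move/(proj2 Xm) => [x [_ ux]]; rewrite -(ux y erefl) -(ux z (esym yz)).
Qed.

(** The terms with [y] in [qstab a] vanish; on the complement, [qop a] reindexes the sum. *)
Lemma sum_sub_qop a (V : zmodType) (F : X -> V) :
  \sum_y (F a - F (qop a y)) =
  F a *+ k + \sum_(s in qstab a) F s - \sum_x F x.
Proof.
have split_sum (G : X -> V) :
    \sum_x G x = \sum_(x in qstab a) G x + \sum_(x in ~: qstab a) G x.
  rewrite (bigID (mem (qstab a))) /=; congr (_ + _).
  by apply: eq_bigl => x; rewrite !inE.
rewrite sumrB sumr_const (split_sum F) (split_sum (F \o qop a)) /=.
rewrite sum_qop_qstabC !opprD !addrA; congr (_ - _); rewrite addrK.
rewrite (eq_bigr (fun=> F a)) => [|s]; last by rewrite inE => /eqP ->.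
by rewrite sumr_const (proj1 Xm) -mulrnBr // -(proj1 Xm a) max_card.
Qed.

(** The factor [k.*2 + m] is the one for which the stabilizer sums cancel. *)
Lemma spread_quadratic n (c : rack_chain X n.+1) :
  spread c *+ (k.*2 + m) - spread (spread c) = c *+ (k * #|X|) - total c *+ k.
Proof.
pose f : {additive rack_chain X n.+1 -> rack_chain X n.+1} :=
  ( *:%R (k.*2 + m)%:R \o @spread n) \- (@spread n \o @spread n).
pose g : {additive rack_chain X n.+1 -> rack_chain X n.+1} :=
  *:%R (k * #|X|)%:R \- ( *:%R k%:R \o @total n).
rewrite -!scaler_nat; apply: (@freeg_additive_ext _ _ f g) => t /=.
rewrite !scaler_nat.
case/cons_tupleP: t => a u.
have kX : (k + m = #|X|)%N by rewrite subnK // -(proj1 Xm a) max_card.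
pose F x : rack_chain X n.+1 := << x ::: u >>.
have spreadF x : spread (F x) =
    F x *+ k + \sum_(s in qstab x) F s - \sum_x F x.
  by rewrite /F spreadU (sum_sub_qop x F).
(* The [m] elements of [qstab a] all have the same stabilizer, so its sum is counted [m] times. *)
have spreadS : spread (\sum_(s in qstab a) F s) =
    (\sum_(s in qstab a) F s) *+ (k + m) - (\sum_x F x) *+ m.
  rewrite raddf_sum /= (eq_bigr (fun s =>
    F s *+ k + \sum_(s in qstab a) F s - \sum_x F x)) => [|s sa].
    by rewrite sumrB big_split /= sumrMnl !sumr_const (proj1 Xm) mulrnDr.
  by rewrite spreadF (qstab_eq sa).
(* Each right translation permutes [X]. *)
have spreadT : spread (\sum_x F x) = 0.
  rewrite raddf_sum /=; under eq_bigr do rewrite /F spreadU.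
  by rewrite exchange_big big1 //= => y _; rewrite sumrB (sum_qop F) subrr.
rewrite -[<< _ >>]/(F a).
have -> : total (F a) = \sum_x F x by rewrite /F totalU.
rewrite spreadF [spread (_ - _)]raddfB /= [spread (_ + _)]raddfD /=.
rewrite [spread (_ *+ _)]raddfMn /= spreadF spreadS spreadT.
(* What remains is linear in three arbitrary chains, so it is checked on integer coefficients. *)
move: (F a) (\sum_(s in _) _) (\sum_x _) => A B C.
apply/eqP/freeg_eqP => v.
rewrite !(coeffB, coeffD, coeffMn, coeff0).
move: (coeff v A) (coeff v B) (coeff v C) kX => x y z.
have mulrnZ (w : int) l : w *+ l = w * l%:Z by rewrite -mulr_natr natz.
move: k => l <-; rewrite !mulrnZ -addnn !PoszM !PoszD; ring.
Qed.

End AlmostQuasigroup.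

(** * Degenerate chains and the reduction [red] *)

Lemma degenerate_cons n a (u : n.-tuple X) :
  degenerate u -> degenerate (a ::: u).
Proof.
move=> [i [j [ij tij]]]; exists (lift ord0 i), (lift ord0 j).
by rewrite !tnthS /= /bump /= ij.
Qed.

Lemma degenerate_cons_inv n a b (u : n.-tuple X) :
  degenerate (a ::: b ::: u) -> a = b \/ degenerate (b ::: u).
Proof.
move=> [i [j [ij tij]]].
have [j' def_j|j0] := unliftP ord0 j; last by rewrite j0 in ij.
have [i' def_i|i0] := unliftP ord0 i; last first.
  left; move: tij; rewrite i0 def_j tnth0 tnthS => ->.
  rewrite (_ : j' = ord0) ?tnth0 //; apply: val_inj => /=.
  by move: ij; rewrite i0 def_j /= /bump /=; lia.
right; exists i', j'; move: ij tij; rewrite def_i def_j !tnthS /= /bump /=.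
by split=> //; lia.
Qed.

Lemma additive_degenerate n p
    (f : {additive rack_chain X n -> rack_chain X p}) :
  (forall t, degenerate t -> f << t >> \in degenerate_chain X p) ->
  forall c, c \in degenerate_chain X n -> f c \in degenerate_chain X p.
Proof.
move=> fD c Dc; rewrite -to_quandle_eq0.
have sub : {subset @degenerate_basis X n <= kernel_pred (to_quandle X p \o f)}.
  by move=> _ /asboolP [t dt ->]; rewrite inE /= to_quandle_eq0; apply: fD.
by have := gen_subgroup_min sub Dc; rewrite inE.
Qed.

Lemma dup_in_degenerate n (c : rack_chain X n.+1) :
  dup c \in degenerate_chain X n.+1.
Proof.
rewrite -to_quandle_eq0; apply/eqP.
apply: (@freeg_additive_ext _ _ (to_quandle X n.+1 \o @dup n) \0) => t /=.
apply/eqP; rewrite to_quandle_eq0; case/cons_tupleP: t => a u.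
case: n c u => [|n] c u; first by rewrite dup1 rpred0.
rewrite dupU; apply: degenerate_in; exists ord0, (lift ord0 ord0).
by rewrite tnthS.
Qed.

Definition red n (c : rack_chain X n.+1) := c - dup c.

Lemma red_is_zmod_morphism n : zmod_morphism (@red n).
Proof. by move=> c d; rewrite /red raddfB !opprD !opprK !addrA (addrAC c). Qed.

HB.instance Definition _ n := GRing.isZmodMorphism.Build
  (rack_chain X n.+1) (rack_chain X n.+1) (@red n) (@red_is_zmod_morphism n).

Lemma total_red n (c : rack_chain X n.+2) : total (red c) = 0.
Proof. by rewrite /red raddfB /= total_dup subrr. Qed.

(** If the first two entries agree, [red] kills the tuple. Otherwise the repetition lies in the
    tail, which [cyl] leaves intact. *)
Lemma cyl_red_degenerate n (c : rack_chain X n.+1) :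
  c \in degenerate_chain X n.+1 ->
  cyl (red c) \in degenerate_chain X n.+2.
Proof.
apply: (@additive_degenerate _ _ (@cyl n \o @red n)) => t /=.
case/cons_tupleP: t => a u; case: n c u => [|n] c u.
  by move=> [i [j]]; rewrite (ord1 i) (ord1 j) => -[].
case/cons_tupleP: u => b u /degenerate_cons_inv; rewrite /red dupU theadE.
move=> [->|du]; first by rewrite subrr raddf0 rpred0.
rewrite raddfB /= !cylU rpredB // rpred_sum // => y _;
  by apply: degenerate_in; do 2 apply: degenerate_cons.
Qed.

Lemma bd_cyl_red n (c : rack_chain X n.+2) :
  bd (cyl (red c)) + cyl (red (bd c)) = spread (red c).
Proof.
rewrite -[RHS]bd_cyl; congr (_ + cyl _).
by rewrite /red [RHS]raddfB /= bd_dup.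
Qed.

(** * Annihilation of cycles *)

Lemma spread_red_bounds n (c : rack_chain X n.+2) :
  bd c \in degenerate_chain X n.+1 ->
  spread (red c) - bd (cyl (red c)) \in degenerate_chain X n.+2.
Proof.
rewrite -bd_cyl_red addrC addrA addNr add0r.
exact: cyl_red_degenerate.
Qed.

(** [spread (red c)] is fixed by [red] and is again a cycle modulo degenerate chains, so the
    previous lemma applies to it. *)
Lemma spread2_red_bounds n (c : rack_chain X n.+2) :
  bd c \in degenerate_chain X n.+1 ->
  spread (spread (red c)) - bd (cyl (spread (red c)))
    \in degenerate_chain X n.+2.
Proof.
move=> Dc; set c1 := spread (red c).
have red_c1 : red c1 = c1 by rewrite /red dup_spread subr0.
rewrite -{1 2}red_c1; apply: spread_red_bounds.
rewrite /c1 -bd_cyl_red raddfD /= bd_bd add0r.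
exact/bd_degenerate/cyl_red_degenerate.
Qed.

Lemma annihilate_relative_cycle n m (c : rack_chain X n.+2) :
  almost_quasigroup X m -> (forall a, trivial_on (qstab a)) ->
  bd c \in degenerate_chain X n.+1 ->
  exists b : rack_chain X n.+3,
    c *+ ((#|X| - m) * #|X|) - bd b \in degenerate_chain X n.+2.
Proof.
move=> Xm Xtriv Dc; have Db2 := spread2_red_bounds Dc; set b2 := cyl _ in Db2.
have Db1 := spread_red_bounds Dc; set b1 := cyl _ in Db1.
(* This mirrors the left side of [spread_quadratic], with [b1] and [b2] bounding [spread (red c)]
   and its [spread] modulo degenerate chains. *)
exists (b1 *+ ((#|X| - m).*2 + m) - b2).
set N := ((#|X| - m) * #|X|)%N; set p := ((#|X| - m).*2 + m)%N.
have := spread_quadratic Xm Xtriv (red c).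
rewrite total_red mul0rn subr0 -/N -/p => quad.
have -> : c *+ N - bd (b1 *+ p - b2) =
    (spread (red c) - bd b1) *+ p - (spread (spread (red c)) - bd b2)
    + dup c *+ N.
  (* The relation applies to [red c]; the remaining [dup c] is degenerate. *)
  rewrite -[in LHS](subrK (dup c) c) -/(red c) mulrnDl -quad.
  have -> : bd (b1 *+ p - b2) = bd b1 *+ p - bd b2 by rewrite raddfB raddfMn.
  rewrite addrAC mulrnBl; congr (_ + _).
  by rewrite !opprB addrACA [RHS]addrACA [- _ - _ in RHS]addrC.
apply: rpredD; last by apply: rpredMn; apply: dup_in_degenerate.
by apply: rpredB => //; apply: rpredMn.
Qed.

Lemma annihilate_augmented_cycle m (c : rack_chain X 1) :
  almost_quasigroup X m -> (forall a, trivial_on (qstab a)) ->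
  deg c = 0 -> exists b : rack_chain X 2, c *+ ((#|X| - m) * #|X|) = bd b.
Proof.
move=> Xm Xtriv c0; have := spread_quadratic Xm Xtriv c.
rewrite total1 c0 mulr0z mul0rn subr0 => <-.
exists (cyl c *+ ((#|X| - m).*2 + m) - cyl (spread c)).
by rewrite raddfB raddfMn /= !bd_cyl1.
Qed.

End QuandleChains.

Theorem corollary3p3 (m : nat) (X : finQuandleType) :
  (0 < m)%N ->
  almost_quasigroup X m ->
  (forall a : X, trivial_subquandle (qstab a)) ->
  ~ trivial_quandle X ->
  forall (n : nat) (h : reduced_homology X n),
    (0 < n)%N -> h *+ (m * lcmn #|X| (#|X| - m)) = 0.
Proof.
move=> _ Xm Xsub _ n h n_gt0.
have Xtriv a : trivial_on (qstab a) := proj2 (Xsub a).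
set k := (#|X| - m)%N.
have /dvdnP [q ->] : (k * #|X| %| m * lcmn #|X| k)%N.
  (* A point of [X] is needed for [m <= #|X|], since the subtraction truncates; for empty [X] both
     sides are 0. *)
  have [a _|X0] := pickP X; last by rewrite eq_card0 // lcm0n !muln0.
  have kX : (k + m = #|X|)%N by rewrite subnK // -(proj1 Xm a) max_card.
  by have := dvdn_mul_mul_lcm k m; rewrite kX.
rewrite mulnC mulrnA; suff -> : h *+ (k * #|X|) = 0 by rewrite mul0rn.
case: n h n_gt0 => [//|n] h _; apply: homology_mulrn_eq0 h.
case: n => [|n] c /=; rewrite -(to_quandle_repr c).
  rewrite augmentation_to_quandle => /(annihilate_augmented_cycle Xm Xtriv).
  move=> [b cb]; exists (to_quandle X 2 b).
  by rewrite qbd_to_quandle -cb raddfMn.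
rewrite qbd_to_quandle => /eqP; rewrite to_quandle_eq0.
move=> /(annihilate_relative_cycle Xm Xtriv) [b cb].
exists (to_quandle X n.+3 b); apply/esym/eqP.
by rewrite qbd_to_quandle -raddfMn -subr_eq0 -raddfB to_quandle_eq0.
Qed.
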